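(* Let each $f_i:\mathbb{R}^m\to\mathbb{R}$ ($i\in[n]$) be coercive and $r+1$ times continuously differentiable for some $r\ge 1$, with $\nabla f_i$ being $L_i$-Lipschitz continuous, and let the undirected graph $\mathcal G$ be connected. Let $\mathbf{x}^0\in\mathbb{R}^{mn}$ be arbitrary, let $0<\alpha<\sigma_{\min}(\mathbf I+\mathbf D)/L_c$, and let $\{\mathbf{x}^\nu\}$ be the sequence generated by DGD from $\mathbf{x}^0$ with step-size $\alpha$. Let $H$ be an upper bound of $\{\|\nabla F_c(\mathbf{x}^\nu)\|\}_{\nu\ge 0}$ and let $\sigma_2<1$ be the second largest singular value of $\mathbf D$. Then every limit point $\mathbf{x}^\infty=[\mathbf{x}_1^{\infty\top},\ldots,\mathbf{x}_n^{\infty\top}]^\top$ of $\{\mathbf{x}^\nu\}$ satisfies $$\|\nabla F(\bar{\mathbf{x}}^\infty)\|\le K'\alpha,\qquad \bar{\mathbf{x}}^\infty\triangleq \frac1n\sum_{i=1}^n\mathbf{x}_i^\infty,\qquad K'=\frac{n\sqrt n\,L_c H}{1-\sigma_2},$$ i.e. $\bar{\mathbf{x}}^\infty$ is a $K'\alpha$-critical point of $F$.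
   Context: Problem: $F(\boldsymbol\theta)=\sum_{i=1}^n f_i(\boldsymbol\theta)$, $\boldsymbol\theta\in\mathbb{R}^m$. For $\mathbf{x}=[\mathbf{x}_1^\top,\ldots,\mathbf{x}_n^\top]^\top\in\mathbb{R}^{mn}$ with $\mathbf{x}_i\in\mathbb{R}^m$, let $F_c(\mathbf{x})=\sum_{i=1}^n f_i(\mathbf{x}_i)$; $L_c=\max_i L_i$ is the Lipschitz constant of $\nabla F_c$. A function is coercive if it tends to $+\infty$ as its argument tends to infinity in norm. A point $\boldsymbol\theta$ is an $\varepsilon$-critical point of $F$ if $\|\nabla F(\boldsymbol\theta)\|\le\varepsilon$. Network: $\mathcal G=([n],\mathcal E)$ is an undirected graph. Weight matrix: $\mathbf D\in\mathbb{R}^{n\times n}$ is nonnegative, doubly stochastic and compliant to $\mathcal G$: $D_{ii}>0$ for all $i$ and, for $i\ne j$, $D_{ij}>0$ if and only if $(j,i)\in\mathcal E$, $D_{ij}=0$ otherwise. DGD with step-size $\alpha>0$ and initialization $\mathbf{x}^0\in\mathbb{R}^{mn}$: $\mathbf{x}^{\nu+1}=\mathbf{W}_D\mathbf{x}^\nu-\alpha\nabla F_c(\mathbf{x}^\nu)$, with $\mathbf{W}_D=\mathbf D\otimes\mathbf I_m$. $\sigma_{\min}(\cdot)$ denotes the smallest singular value.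
   Formalization: The weight matrix D is additionally assumed symmetric; for a nonsymmetric doubly stochastic compliant D (possible when n ≥ 3) DGD can cycle among points where the gradient of F at the mean exceeds K'α, so the claim fails. *)

(* Defs.v *)
From mathcomp Require Import all_boot all_order all_algebra.
From mathcomp Require Import all_classical all_reals all_analysis.
From mathcomp Require Import polyrcf mxtens.
Import Order.TTheory GRing.Theory Num.Theory numFieldNormedType.Exports.

Set Implicit Arguments.
Unset Strict Implicit.
Unset Printing Implicit Defensive.

Local Open Scope classical_set_scope.
Local Open Scope ring_scope.

(* The norm `|x| of a matrix in MathComp-Analysis is the sup norm; it is only
   used here through the (equivalent) topology it induces. *)
Definition enorm (R : realType) (d : nat) (x : 'cV[R]_d) : R :=
  Num.sqrt (\sum_(k < d) x k ord0 ^+ 2).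

Definition partial (R : realType) (d : nat) (k : 'I_d)
    (f : 'cV[R]_d -> R) (x : 'cV[R]_d) : R :=
  'D_(delta_mx k ord0) f x.

Definition grad (R : realType) (d : nat) (f : 'cV[R]_d -> R) (x : 'cV[R]_d) :
    'cV[R]_d :=
  \col_(k < d) partial k f x.

Fixpoint Ck (R : realType) (d r : nat) (f : 'cV[R]_d -> R) : Prop :=
  match r with
  | 0%N => continuous f
  | r'.+1 => (forall x, differentiable f x) /\
             (forall k : 'I_d, Ck r' (partial k f))
  end.

Definition coercive (R : realType) (d : nat) (f : 'cV[R]_d -> R) : Prop :=
  forall A : R, exists B : R, forall x, B <= enorm x -> A <= f x.

Definition grad_lipschitz (R : realType) (d : nat) (f : 'cV[R]_d -> R) (L : R)
    : Prop :=
  forall x y, enorm (grad f x - grad f y) <= L * enorm (x - y).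

Definition eps_critical (R : realType) (d : nat) (f : 'cV[R]_d -> R) (eps : R)
    (x : 'cV[R]_d) : Prop :=
  enorm (grad f x) <= eps.

(* Square roots of the eigenvalues of A^T A, repeated according to algebraic
   multiplicity, in nonincreasing order (rootsR lists the distinct real roots
   in increasing order). *)
Definition singular_values (R : realType) (n : nat) (A : 'M[R]_n) : seq R :=
  let p : {poly R} := char_poly (A^T *m A) in
  rev (flatten [seq nseq (mup l p) (Num.sqrt l) | l <- rootsR p]).

Definition sigma_min (R : realType) (n : nat) (A : 'M[R]_n) : R :=
  last 0 (singular_values A).

(* Singular values are indexed from 0; by convention sigma2 is 0 if n < 2. *)
Definition sigma2 (R : realType) (n : nat) (A : 'M[R]_n) : R :=
  (singular_values A)`_1.

Definition doubly_stochastic (R : realType) (n : nat) (D : 'M[R]_n) : Prop :=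
  [/\ forall i j, 0 <= D i j,
      forall i, \sum_(j < n) D i j = 1 &
      forall j, \sum_(i < n) D i j = 1].

Definition compliant (R : realType) (n : nat) (E : rel 'I_n) (D : 'M[R]_n)
    : Prop :=
  (forall i, 0 < D i i) /\
  (forall i j, i != j -> (0 < D i j <-> E j i) /\ (~~ E j i -> D i j = 0)).

Definition connected_graph (n : nat) (E : rel 'I_n) : Prop :=
  forall i j, connect E i j.

(* Stacked vectors [x_1; ...; x_n] of R^(nm): the k-th coordinate of x_i has
   index i * m + k, as in the Kronecker product *t. *)
Definition block (R : realType) (n m : nat) (x : 'cV[R]_(n * m)) (i : 'I_n)
    : 'cV[R]_m :=
  \col_(k < m) x (mxtens_index (i, k)) ord0.

Definition block_mean (R : realType) (n m : nat) (x : 'cV[R]_(n * m))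
    : 'cV[R]_m :=
  n%:R^-1 *: \sum_(i < n) block x i.

Definition Fsum (R : realType) (n m : nat) (f : 'I_n -> 'cV[R]_m -> R)
    (theta : 'cV[R]_m) : R :=
  \sum_(i < n) f i theta.

Definition Fc (R : realType) (n m : nat) (f : 'I_n -> 'cV[R]_m -> R)
    (x : 'cV[R]_(n * m)) : R :=
  \sum_(i < n) f i (block x i).

(* The default value 0 is harmless: Lipschitz constants are nonnegative as soon
   as the domain has two points. *)
Definition Lmax (R : realType) (n : nat) (L : 'I_n -> R) : R :=
  \big[Num.max/0]_(i < n) L i.

Definition W (R : realType) (n : nat) (m : nat) (D : 'M[R]_n)
    : 'M[R]_(n * m) :=
  D *t (1%:M : 'M[R]_m).

Fixpoint dgd (R : realType) (n m : nat) (D : 'M[R]_n)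
    (f : 'I_n -> 'cV[R]_m -> R) (alpha : R) (x0 : 'cV[R]_(n * m)) (nu : nat)
    : 'cV[R]_(n * m) :=
  match nu with
  | 0%N => x0
  | nu'.+1 => let x := dgd D f alpha x0 nu' in
              W m D *m x - alpha *: grad (Fc f) x
  end.

Definition seq_limit_point (R : realType) (d : nat) (u : nat -> 'cV[R]_d)
    (p : 'cV[R]_d) : Prop :=
  cluster (u @ \oo) p.

(* Main.v *)
Require Import Defs.
From mathcomp Require Import all_boot all_order all_algebra.
From mathcomp Require Import all_classical all_reals all_analysis.
From mathcomp Require Import polyrcf mxtens complex spectral.
From mathcomp Require Import ring lra.
Import Order.TTheory GRing.Theory Num.Theory numFieldNormedType.Exports.
Local Open Scope ring_scope.

(** DGD is gradient descent with unit step on the energy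
    [alpha * Fc x + (dot x x - dot x (W x)) / 2]. The step-size condition
    [alpha * L_c < sigma_min (1 + D)] makes each step decrease
    this energy by at least a positive multiple of the squared step length
    ([dgd_energy_descent]). The energy is bounded below, because each [f i] is
    coercive and the form of [1 - W] is nonnegative; hence the steps tend to
    zero, and since the step is a Lipschitz function of the iterate it vanishes
    at every limit point [p] ([limit_point_stationary]):
    [W p - p = alpha *: grad (Fc f) p].

    This equation has two consequences. Averaged over the agents, it says that
    the gradients [grad (f i) p_i] sum to zero ([stationary_grad_sum]). On the
    orthogonal complement of the consensus space, where [D] contracts by
    [sigma2 D < 1], it says that the distance from [p] to its block mean is at
    most [alpha * H / (1 - sigma2 D)] ([consensus_error]). The gradient of the
    sum at the mean is therefore a sum of increments of gradients over these
    small distances ([stationary_mean_critical]).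

    The spectral input is that the singular values of a symmetric matrix are
    the sorted absolute values of its eigenvalues
    ([singular_values_diagonalizes]). It gives the Rayleigh bound for
    [sigma_min] ([sigma_min_Rayleigh]) and, through the simplicity of the
    eigenvalue 1 of the mixing matrix of a connected graph, the contraction
    factor [sigma2 D] ([sigma2_gap]). *)

Set Implicit Arguments.
Unset Strict Implicit.
Unset Printing Implicit Defensive.

(** * Euclidean geometry of column vectors *)

Definition dot (R : pzRingType) (d : nat) (u v : 'cV[R]_d) : R :=
  \sum_(k < d) u k ord0 * v k ord0.

Section Dot.
Variables (R : realType) (d : nat).
Implicit Types (u v w : 'cV[R]_d) (A : 'M[R]_d).

Lemma dotC u v : dot u v = dot v u.
Proof. by apply: eq_bigr => k _; rewrite mulrC. Qed.

Lemma dotDr u v w : dot u (v + w) = dot u v + dot u w.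
Proof. by rewrite -big_split; apply: eq_bigr => k _; rewrite mxE mulrDr. Qed.

Lemma dotDl u v w : dot (v + w) u = dot v u + dot w u.
Proof. by rewrite dotC dotDr !(dotC u). Qed.

Lemma dotZr a u v : dot u (a *: v) = a * dot u v.
Proof. by rewrite mulr_sumr; apply: eq_bigr => k _; rewrite mxE mulrCA. Qed.

Lemma dotZl a u v : dot (a *: v) u = a * dot v u.
Proof. by rewrite dotC dotZr dotC. Qed.

Lemma dotNr u v : dot u (- v) = - dot u v.
Proof. by rewrite -scaleN1r dotZr mulN1r. Qed.

Lemma dotNl u v : dot (- v) u = - dot v u.
Proof. by rewrite dotC dotNr dotC. Qed.

Lemma dot_ge0 u : 0 <= dot u u.
Proof. by apply: sumr_ge0 => k _; rewrite -expr2 sqr_ge0. Qed.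

Lemma dot_eq0 u : (dot u u == 0) = (u == 0).
Proof.
apply/idP/eqP => [|->]; last by rewrite /dot big1 // => k _; rewrite mxE mul0r.
rewrite psumr_eq0 => [/allP u0|k _]; last by rewrite -expr2 sqr_ge0.
apply/colP => k; have := u0 k (mem_index_enum k).
by rewrite mxE -expr2 sqrf_eq0 => /eqP.
Qed.

Lemma dot_mulmx_sym A u v : A^T = A -> dot (A *m u) v = dot u (A *m v).
Proof.
move=> symA; rewrite /dot.
under eq_bigr do rewrite mxE mulr_suml.
under [RHS]eq_bigr do rewrite mxE mulr_sumr.
rewrite exchange_big; apply: eq_bigr => i _; apply: eq_bigr => j _.
by rewrite -[in LHS]symA mxE mulrCA mulrA.
Qed.
End Dot.

Section EuclideanNorm.
Variables (R : realType) (d : nat).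
Implicit Types u v w : 'cV[R]_d.

Lemma enormE u : enorm u = Num.sqrt (dot u u).
Proof. by congr Num.sqrt; apply: eq_bigr => k _; rewrite expr2. Qed.

Lemma enorm_ge0 u : 0 <= enorm u.
Proof. exact: sqrtr_ge0. Qed.

Lemma sqr_enorm u : enorm u ^+ 2 = dot u u.
Proof. by rewrite enormE sqr_sqrtr // dot_ge0. Qed.

Lemma enormZ a u : enorm (a *: u) = `|a| * enorm u.
Proof.
by rewrite !enormE dotZl dotZr mulrA -expr2 sqrtrM ?sqr_ge0 // sqrtr_sqr.
Qed.

Lemma enormN u : enorm (- u) = enorm u.
Proof. by rewrite -scaleN1r enormZ normrN1 mul1r. Qed.

Lemma enorm0 : enorm (0 : 'cV[R]_d) = 0.
Proof. by rewrite -(scale0r 0) enormZ normr0 mul0r. Qed.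

Lemma enorm_eq0 u : (enorm u == 0) = (u == 0).
Proof. by rewrite -sqrf_eq0 sqr_enorm dot_eq0. Qed.

(** Positivity of [dot w w] at [w = dot v v *: u - dot u v *: v], divided by
    [dot v v]. *)
Lemma cauchy_schwarz u v : dot u v ^+ 2 <= dot u u * dot v v.
Proof.
have [->|v0] := eqVneq v 0.
  have z w : dot w (0 : 'cV[R]_d) = 0 by rewrite -(scale0r 0) dotZr mul0r.
  by rewrite !z mulr0 expr0n.
have vv : 0 < dot v v by rewrite lt_neqAle dot_ge0 eq_sym dot_eq0 v0.
rewrite -subr_ge0 -(pmulr_rge0 _ vv).
have := dot_ge0 (dot v v *: u + - dot u v *: v).
rewrite !(dotDl, dotDr, dotZl, dotZr) (dotC v u).
by congr (0 <= _); ring.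
Qed.

Lemma dot_le_enorm u v : dot u v <= enorm u * enorm v.
Proof.
apply: (le_trans (ler_norm _)).
rewrite -(@ler_pXn2r _ 2) // ?nnegrE ?mulr_ge0 ?enorm_ge0 //.
by rewrite real_normK ?num_real // exprMn !sqr_enorm cauchy_schwarz.
Qed.

Lemma enormD u v : enorm (u + v) <= enorm u + enorm v.
Proof.
rewrite -(@ler_pXn2r _ 2) // ?nnegrE ?addr_ge0 ?enorm_ge0 //.
rewrite sqrrD !sqr_enorm dotDl !dotDr (dotC v u).
by have := dot_le_enorm u v; lra.
Qed.

Lemma enormB u v : enorm (u - v) = enorm (v - u).
Proof. by rewrite -enormN opprB. Qed.

Lemma enorm_sum (I : Type) (r : seq I) (F : I -> 'cV[R]_d) :
  enorm (\sum_(i <- r) F i) <= \sum_(i <- r) enorm (F i).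
Proof.
elim/big_ind2 : _ => [|u a v b ua vb|//]; first by rewrite enorm0.
by rewrite (le_trans (enormD _ _)) // lerD.
Qed.

(** The topology on matrices is given by the sup norm, and the Euclidean norm is
    at most [sqrt d] times the sup norm. *)
Lemma nbhs_enorm (p : 'cV[R]_d) (e : R) : 0 < e ->
  nbhs p [set x | enorm (x - p) < e]%classic.
Proof.
(* The radius [e / (d + 1)] suffices since [d < (d + 1) ^ 2]; adding 1 keeps it
   defined in dimension 0. *)
move=> e0; pose c : R := d%:R + 1.
have c0 : 0 < c by rewrite ltr_wpDl.
apply/nbhs_ballP; exists (e / c) => /=; first by rewrite divr_gt0.
move=> x; rewrite -ball_normE /= => xp.
have xk k : `|(x - p) k 0| <= e / c.
  rewrite -opprB mxE normrN; apply/ltW/(le_lt_trans _ xp).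
  rewrite /Num.Def.normr /= mx_normrE.
  exact: (le_bigmax _ (fun ij : 'I_d * 'I_1 => `|(p - x) ij.1 ij.2|) (k, 0)).
rewrite -(@ltr_pXn2r _ 2) // ?nnegrE ?enorm_ge0 ?ltW // sqr_enorm.
apply: (@le_lt_trans _ _ (d%:R * (e / c) ^+ 2)).
  rewrite mulr_natl -[X in _ *+ X]card_ord -sumr_const; apply: ler_sum => k _.
  by rewrite -expr2 -real_normK ?num_real // lerXn2r ?nnegrE // ltW ?divr_gt0.
rewrite expr_div_n mulrCA gtr_pMr ?exprn_gt0 // ltr_pdivrMr ?exprn_gt0 // mul1r.
have : 0 <= d%:R :> R by [].
by rewrite /c; nra.
Qed.
End EuclideanNorm.

(** * Spectra and singular values of symmetric matrices *)

Section Spectrum.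
Variables (R : realType) (n : nat).
Implicit Types (A B : 'M[R]_n) (lam : 'rV[R]_n) (v w : 'cV[R]_n).
Local Notation C := (complex R).
Local Notation toC := (real_complex R).
Local Notation "M ^C" := (map_mx toC M) : ring_scope.

(** The eigenvalues are real but the change of basis is allowed to be complex:
    the quadratic forms below only involve the squared moduli of the coordinates
    of [P *m v], so that a unitary [P] serves as well as an orthogonal one. *)
Definition diagonalizes (P : 'M[C]_n) A lam :=
  P *m A^C = diag_mx lam^C *m P.

Lemma symmetric_diagonalizes A : A^T = A ->
  exists (P : 'M[C]_n) lam, P \is unitarymx /\ diagonalizes P A lam.
Proof.
move=> symA; have hA : A^C \is hermsymmx.
  apply: realsym_hermsym; last first.
    by apply/mxOverP => i j; rewrite mxE; apply/complex_realP; exists (A i j).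
  by apply/is_hermitianmxP; rewrite expr0 scale1r map_mx_id // map_trmx symA.
have /orthomx_spectralP eA := hermitian_normalmx hA.
pose P := spectralmx A^C.
exists P, (\row_i complex.Re (spectral_diag A^C 0 i)); split.
  exact: spectral_unitarymx.
rewrite /diagonalizes.
have -> : (\row_i complex.Re (spectral_diag A^C 0 i))^C = spectral_diag A^C.
  apply/rowP => i; rewrite !mxE; apply: RRe_real.
  by have /mxOverP := hermitian_spectral_diag_real hA.
by rewrite [in LHS]eA !mulmxA mulmxV ?mul1mx // spectral_unit.
Qed.

(** Over the complex numbers [P] conjugates [A] to a diagonal matrix, and the
    product formula descends along the injection of the reals. *)
Lemma char_poly_diagonalizes P A lam : P \in unitmx -> diagonalizes P A lam ->
  char_poly A = \prod_(i < n) ('X - (lam 0 i)%:P).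
Proof.
move=> uP dA; apply: (map_poly_inj toC).
rewrite rmorph_prod map_char_poly.
transitivity (char_poly (diag_mx lam^C)); last first.
  rewrite char_poly_trig ?diag_mx_is_trig //; apply: eq_bigr => i _.
  by rewrite rmorphB /= map_polyX map_polyC !mxE eqxx.
rewrite /char_poly -[LHS]mul1r -[RHS]mulr1.
have uQ : \det (map_mx polyC P) \is a GRing.unit.
  by rewrite det_map_mx rmorph_unit // -unitmxE.
apply: (mulrI uQ); rewrite mul1r mulr1 [RHS]mulrC -!det_mulmx; congr (\det _).
rewrite /char_poly_mx mulmxBr mulmxBl -!map_mxM dA.
by rewrite mul_mx_scalar mul_scalar_mx.
Qed.

Lemma diagonalizesM P A lam : diagonalizes P A lam ->
  diagonalizes P (A *m A) (\row_i lam 0 i ^+ 2).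
Proof.
move=> dA; rewrite /diagonalizes map_mxM mulmxA dA -mulmxA dA mulmxA.
congr (_ *m P); apply/matrixP => i j; rewrite mul_diag_mx !mxE.
by rewrite mulrnAr rmorphXn expr2.
Qed.

(** [A^T *m A = A *m A] has the squares of the eigenvalues of [A] as its roots,
    and listing each distinct root with its multiplicity gives a sorted
    permutation of them; two sorted permutations of a list are equal. *)
Lemma singular_values_diagonalizes P A lam : A^T = A -> P \in unitmx ->
  diagonalizes P A lam ->
  singular_values A = sort >=%R [seq `|lam 0 i| | i <- enum 'I_n].
Proof.
move=> symA uP dA; rewrite /singular_values symA.
set p := char_poly _.
pose mu := [seq lam 0 i ^+ 2 | i <- enum 'I_n].
have pE : p = \prod_(x <- mu) ('X - x%:P).
  rewrite /p (char_poly_diagonalizes uP (diagonalizesM dA)) big_map big_enum.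
  by apply: eq_bigr => i _; rewrite mxE.
have p0 : p != 0 by rewrite monic_neq0 // char_poly_monic.
have srt : sorted <%R (rootsR p) by exact: sorted_roots.
have memr x : (x \in rootsR p) = (x \in mu).
  have /(_ x) := roots_on_rootsR p0; rewrite in_itv /= => <-.
  by rewrite pE root_prod_XsubC.
pose s := flatten [seq nseq (mup l p) l | l <- rootsR p].
have -> : flatten [seq nseq (mup l p) (Num.sqrt l) | l <- rootsR p] =
   map Num.sqrt s.
  rewrite /s map_flatten -map_comp; congr flatten.
  by apply: eq_map => x /=; rewrite map_nseq.
have perm_s : perm_eq s mu.
  apply: perm_trans (perm_count_undup mu).
  have -> : s = flatten [seq nseq (count_mem x mu) x | x <- rootsR p].
    by congr flatten; apply: eq_map => x; rewrite pE mu_prod_XsubC.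
  apply/perm_flatten/perm_map/uniq_perm; rewrite ?undup_uniq //.
    exact: lt_sorted_uniq.
  by move=> x; rewrite mem_undup memr.
have sorted_s : sorted <=%R s.
  rewrite /s; elim: (rootsR p) srt => //= a l IH.
  rewrite lt_path_sortedE => /andP[al sl].
  rewrite le_sorted_pairwise pairwise_cat -!le_sorted_pairwise IH // andbT.
  apply/andP; split.
    apply/allrelP => x y /nseqP[-> _] /flattenP[t /mapP[z zl ->]] /nseqP[-> _].
    by move/allP: al => /(_ z zl) /ltW.
  by elim: (mup a p) => [|[|k] IHk] //=; rewrite lexx.
apply: (@sorted_eq _ >=%R).
- by move=> x y z yx zy; exact: le_trans yx.
- by move=> x y /andP[xy yx]; apply/le_anti/andP; split.
- rewrite rev_sorted sorted_map; apply: sub_sorted sorted_s => x y /= xy.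
  exact: ler_wsqrtr.
- by apply: sort_sorted => x y; exact: le_total.
rewrite perm_sym perm_sort perm_sym perm_rev.
rewrite (eq_map (g := Num.sqrt \o (fun i => lam 0 i ^+ 2))); last first.
  by move=> i /=; rewrite sqrtr_sqr.
by rewrite map_comp; apply: perm_map.
Qed.

(** Makes the second singular value readable as the head of a sorted list. *)
Lemma singular_values_split P A lam i0 : A^T = A -> P \in unitmx ->
  diagonalizes P A lam -> (forall i, `|lam 0 i| <= `|lam 0 i0|) ->
  singular_values A =
    `|lam 0 i0| :: sort >=%R [seq `|lam 0 i| | i <- enum (predC1 i0)].
Proof.
move=> symA uP dA max_i0; rewrite (singular_values_diagonalizes symA uP dA).
set others := [seq _ | i <- enum (predC1 i0)].
apply: (@sorted_eq _ >=%R).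
- by move=> x y z yx zy; exact: le_trans yx.
- by move=> x y /andP[xy yx]; apply/le_anti/andP; split.
- by apply: sort_sorted => x y; exact: le_total.
- rewrite /= path_min_sorted.
    by apply: sort_sorted => x y; exact: le_total.
  by apply/allP => x; rewrite mem_sort => /mapP[i _ ->] /=; exact: max_i0.
rewrite perm_sort perm_sym; apply: (@perm_trans _ (`|lam 0 i0| :: others)).
  by rewrite perm_cons perm_sort.
rewrite /others -(map_cons (fun i => `|lam 0 i|)); apply: perm_map.
apply: uniq_perm; rewrite ?enum_uniq //= ?mem_enum ?inE ?eqxx ?enum_uniq //.
by move=> i; rewrite inE !mem_enum !inE orbN.
Qed.

Lemma dot_unitary (P : 'M[C]_n) v w : P \is unitarymx ->
  (dot v w)%:C%C = \sum_i ((P *m v^C) i 0)^* * (P *m w^C) i 0.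
Proof.
move=> uP; transitivity (((P *m v^C)^t* *m (P *m w^C)) 0 0)%sesqui; last first.
  by rewrite mxE; apply: eq_bigr => i _; rewrite !mxE.
rewrite trmx_mul map_mxM /= mulmxA -[_ *m _ *m P]mulmxA.
have /unitarymxP/mulmx1C -> := uP.
rewrite mulmx1 mxE /dot rmorph_sum; apply: eq_bigr => i _.
rewrite !mxE rmorphM conj_Creal //; apply/complex_realP; by eexists.
Qed.

Lemma dot_diagonalizes P A lam v : P \is unitarymx -> diagonalizes P A lam ->
  (dot v (A *m v))%:C%C = \sum_i (lam 0 i)%:C%C * `|(P *m v^C) i 0| ^+ 2.
Proof.
move=> uP dA; rewrite (dot_unitary _ _ uP); apply: eq_bigr => i _.
rewrite map_mxM mulmxA dA -mulmxA mul_diag_mx !mxE mulrCA.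
by rewrite normCK [X in _ * X]mulrC.
Qed.

Lemma diagonalizes_eigenvector P A lam i : A^T = A -> P \in unitmx ->
  diagonalizes P A lam -> exists2 v : 'cV[R]_n, v != 0 & A *m v = lam 0 i *: v.
Proof.
move=> symA uP dA; have : eigenvalue A (lam 0 i).
  rewrite eigenvalue_root_char (char_poly_diagonalizes uP dA).
  by rewrite rootE horner_prod (bigD1 i) //= hornerXsubC subrr mul0r.
case/eigenvalueP => u uA u0; exists u^T; first by rewrite trmx_eq0.
by rewrite -{1}symA -trmx_mul uA linearZ.
Qed.
End Spectrum.

Section SigmaMin.
Variables (R : realType) (n : nat).

Lemma last_sorted_ge (s : seq R) x : sorted >=%R s -> x \in s -> last 0 s <= x.
Proof.
case/lastP: s => // s y; rewrite last_rcons mem_rcons inE.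
rewrite sorted_pairwise; last by move=> a b c ba cb; exact: le_trans ba.
rewrite pairwise_rcons => /andP[/allP ys _] /orP[/eqP-> //|xs].
exact: ys xs.
Qed.

(** For a positive semidefinite matrix the singular values are the eigenvalues
    themselves, so the Rayleigh quotient is an average of singular values. *)
Lemma sigma_min_Rayleigh (A : 'M[R]_n) : A^T = A ->
  (forall v, 0 <= dot v (A *m v)) ->
  forall v, sigma_min A * dot v v <= dot v (A *m v).
Proof.
move=> symA psdA v.
have [P [lam [uP dA]]] := symmetric_diagonalizes symA.
have unP := unitarymx_unit uP.
have lam_ge0 i : 0 <= lam 0 i.
  have [w w0 Aw] := diagonalizes_eigenvector i symA unP dA.
  have := psdA w; rewrite Aw dotZr pmulr_lge0 //.
  by rewrite lt_neqAle dot_ge0 eq_sym dot_eq0 w0.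
have min_lam i : sigma_min A <= lam 0 i.
  rewrite /sigma_min (singular_values_diagonalizes symA unP dA).
  rewrite -[lam 0 i]ger0_norm //; apply: last_sorted_ge.
    by apply: sort_sorted => x y; exact: le_total.
  by rewrite mem_sort; apply: map_f; rewrite mem_enum.
rewrite -lecR (dot_diagonalizes _ uP dA) rmorphM /= (dot_unitary _ _ uP).
rewrite mulr_sumr; apply: ler_sum => i _.
by rewrite [X in _ * X]mulrC -normCK ler_wpM2r ?lecR ?exprn_ge0.
Qed.
End SigmaMin.

(** * Doubly stochastic matrices and the spectral gap *)

Section DoublyStochastic.
Variables (R : realType) (n : nat).
Implicit Types (S D : 'M[R]_n) (v : 'cV[R]_n).

(** Expanding the square, the diagonal terms collapse since rows and columns sum
    to 1. With [s = -1] and [s = 1] this writes the quadratic forms of [1 - S]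
    and [1 + S] as sums of squares. *)
Lemma doubly_stochastic_energy S v (s : R) : doubly_stochastic S ->
  \sum_i \sum_j S i j * (v i 0 + s * v j 0) ^+ 2 =
  (1 + s ^+ 2) * dot v v + 2 * s * dot v (S *m v).
Proof.
move=> [_ row1 col1].
have -> : dot v (S *m v) = \sum_i \sum_j S i j * (v i 0 * v j 0).
  apply: eq_bigr => i _; rewrite mxE mulr_sumr.
  by apply: eq_bigr => j _; rewrite mulrCA.
have e1 : dot v v = \sum_i \sum_j S i j * v i 0 ^+ 2.
  by apply: eq_bigr => i _; rewrite -mulr_suml row1 mul1r.
have e2 : dot v v = \sum_i \sum_j S i j * v j 0 ^+ 2.
  rewrite exchange_big; apply: eq_bigr => i _.
  by rewrite -mulr_suml col1 mul1r.
rewrite mulrDl mul1r {1}e1 e2 !mulr_sumr -!big_split; apply: eq_bigr => i _ /=.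
rewrite !mulr_sumr -!big_split; apply: eq_bigr => j _ /=.
by ring.
Qed.

Lemma doubly_stochastic_energy_ge0 S v (s : R) : doubly_stochastic S ->
  0 <= \sum_i \sum_j S i j * (v i 0 + s * v j 0) ^+ 2.
Proof.
move=> [S0 _ _]; apply: sumr_ge0 => i _; apply: sumr_ge0 => j _.
by rewrite mulr_ge0 ?sqr_ge0.
Qed.

Lemma doubly_stochastic_dot_le S v : doubly_stochastic S ->
  dot v (S *m v) <= dot v v.
Proof.
move=> dS; have := doubly_stochastic_energy_ge0 v (-1) dS.
by rewrite doubly_stochastic_energy //; lra.
Qed.

Lemma doubly_stochastic_dot_ge S v : doubly_stochastic S ->
  - dot v v <= dot v (S *m v).
Proof.
move=> dS; have := doubly_stochastic_energy_ge0 v 1 dS.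
by rewrite doubly_stochastic_energy //; lra.
Qed.

Lemma doubly_stochasticM S D : doubly_stochastic S -> doubly_stochastic D ->
  doubly_stochastic (S *m D).
Proof.
move=> [S0 Sr Sc] [D0 Dr Dc]; split=> [i j|i|j].
- by rewrite mxE sumr_ge0 // => k _; rewrite mulr_ge0.
- under eq_bigr do rewrite mxE.
  rewrite exchange_big -[RHS](Sr i); apply: eq_bigr => k _.
  by rewrite -mulr_sumr Dr mulr1.
under eq_bigr do rewrite mxE.
rewrite exchange_big -[RHS](Dc j); apply: eq_bigr => k _.
by rewrite -mulr_suml Sc mul1r.
Qed.

Lemma doubly_stochastic_contracts D v : doubly_stochastic D -> D^T = D ->
  dot (D *m v) (D *m v) <= dot v v.
Proof.
move=> dD symD; rewrite dot_mulmx_sym // mulmxA.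
exact/doubly_stochastic_dot_le/doubly_stochasticM.
Qed.

Variables (E : rel 'I_n) (D : 'M[R]_n).
Hypotheses (dsD : doubly_stochastic D) (symD : D^T = D).
Hypotheses (cD : compliant E D) (cE : connected_graph E).

(** For a fixed vector the energy of [D *m D] with [s = -1] vanishes, so the
    vector takes equal values at [i] and [j] whenever [(D *m D) i j > 0]. This
    holds along edges, because the positive diagonal of [D] gives
    [(D *m D) i j >= D i i * D i j], and connectedness propagates equality.
    Working with the square excludes the eigenvalue -1 along with multiplicity
    of the eigenvalue 1. *)
Lemma fixed_by_square_constant v : D *m (D *m v) = v ->
  forall i j, v i 0 = v j 0.
Proof.
move=> fixv.
have dsDD := doubly_stochasticM dsD dsD.
have [DD0 _ _] := dsDD; have [D0 _ _] := dsD.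
have zero i j : (D *m D) i j * (v i 0 + -1 * v j 0) ^+ 2 = 0.
  have : \sum_i \sum_j (D *m D) i j * (v i 0 + -1 * v j 0) ^+ 2 = 0.
    by rewrite doubly_stochastic_energy // -mulmxA fixv; ring.
  move=> /eqP; rewrite psumr_eq0 => [/allP/(_ i (mem_index_enum i))|k _].
    rewrite /= psumr_eq0 => [/allP/(_ j (mem_index_enum j))/eqP //|k _].
    by rewrite mulr_ge0 ?sqr_ge0.
  by rewrite sumr_ge0 // => l _; rewrite mulr_ge0 ?sqr_ge0.
have step i j : E i j -> v i 0 = v j 0.
  move=> Eij; have [->//|nij] := eqVneq i j.
  have DDij : 0 < (D *m D) i j.
    rewrite mxE (bigD1 i) //= ltr_wpDr ?sumr_ge0 // => [k _|].
      by rewrite mulr_ge0.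
    rewrite mulr_gt0 ?cD.1 // -symD mxE.
    by apply/(cD.2 j i _).1 => //; rewrite eq_sym.
  move/eqP: (zero i j); rewrite mulf_eq0 gt_eqF //= sqrf_eq0 mulN1r subr_eq0.
  by move/eqP.
move=> i j; have /connectP[p Ep ->] := cE i j.
by elim: p i Ep => //= k p IHp i /andP[/step -> /IHp].
Qed.

Section UnitaryDiagonalization.
Variables (P : 'M[complex R]_n) (lam : 'rV[R]_n).
Hypotheses (uP : P \is unitarymx) (dP : diagonalizes P D lam).
Let unP : P \in unitmx := unitarymx_unit uP.

Lemma doubly_stochastic_spectrum_le1 i : `|lam 0 i| <= 1.
Proof.
have [w w0 Dw] := diagonalizes_eigenvector i symD unP dP.
have := doubly_stochastic_contracts w dsD symD.
rewrite Dw dotZl dotZr mulrA -expr2 ger_pMl; last first.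
  by rewrite lt_neqAle dot_ge0 eq_sym dot_eq0 w0.
by rewrite -real_normK ?num_real // expr_le1.
Qed.

(** The square of an eigenvalue of modulus 1 is the eigenvalue 1 of [D *m D],
    whose fixed vectors are constant. The conclusion is about a row of [P] since
    the simplicity of the eigenvalue 1 follows by comparing two such rows. *)
Lemma unimodular_row_constant i : `|lam 0 i| = 1 ->
  forall j k, P i j = P i k.
Proof.
move=> lam1; have dPP := diagonalizesM dP.
have symDD l k : (D *m D) l k = (D *m D) k l.
  by rewrite -{1 2}symD -trmx_mul mxE.
have fixP : row i P *m map_mx (real_complex R) (D *m D) = row i P.
  rewrite -row_mul dPP; apply/rowP => j; rewrite mxE mul_diag_mx !mxE.
  by rewrite -[lam 0 i ^+ 2]real_normK ?num_real // lam1 expr1n mul1r.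
(* Real and imaginary parts are both additive and R-homogeneous, so that each
   of them turns the complex fixed row into a real fixed vector. *)
have fixr (g : complex R -> R) : {morph g : x y / x + y} ->
    (forall x a, g (x * a%:C%C) = g x * a) ->
    forall j k, g (P i j) = g (P i k).
  move=> gD gM; pose v := \col_j g (P i j).
  have g0 : g 0 = 0.
    by have := gM 0 0; rewrite mul0r mulr0.
  have fixv : D *m (D *m v) = v.
    rewrite mulmxA; apply/colP => k; rewrite mxE [v k 0]mxE.
    have /rowP/(_ k) := fixP; rewrite mxE [row i P 0 k]mxE => <-.
    rewrite (big_morph g gD g0); apply: eq_bigr => l _.
    by rewrite [row i P 0 l]mxE [map_mx _ _ l k]mxE gM mulrC symDD [v l 0]mxE.
  by move=> j k; have := fixed_by_square_constant fixv j k; rewrite !mxE.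
move=> j k; apply/eqP; rewrite eq_complex; apply/andP; split; apply/eqP.
  apply: fixr => [[? ?] [? ?]|[a b] c] //=.
  by rewrite mulr0 subr0.
apply: fixr => [[? ?] [? ?]|[a b] c] //=.
by rewrite mulr0 add0r.
Qed.

(** The Perron-Frobenius part: the constant vector, fixed by [D], must have a
    component on some row of [P], which gives the eigenvalue 1; a second row
    with unimodular eigenvalue would also be constant, and two nonzero constant
    rows are not orthogonal. *)
Lemma simple_unit_eigenvalue : (0 < n)%N ->
  exists2 i0, lam 0 i0 = 1 & forall i, i != i0 -> `|lam 0 i| < 1.
Proof.
move=> n_gt0; pose one : 'cV[R]_n := const_mx 1.
have row_norm i j : \sum_k P i k * (P j k)^* = (i == j)%:R.
  have /unitarymxP/matrixP/(_ i j) := uP; rewrite !mxE => <-.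
  by apply: eq_bigr => k _; rewrite !mxE.
have one_fixed : D *m one = one.
  apply/colP => i; rewrite !mxE; have [_ row1 _] := dsD; rewrite -[RHS](row1 i).
  by apply: eq_bigr => j _; rewrite mxE mulr1.
have [i0 lam_i0] : exists i, lam 0 i = 1.
  have : ~~ [forall i, (P *m map_mx (real_complex R) one) i 0 == 0].
    apply/negP => /forallP P1.
    have := dot_unitary one one uP; rewrite big1 => [|i _]; last first.
      by rewrite (eqP (P1 i)) mulr0.
    move/eqP; rewrite eq_complex eqxx andbT /= => /eqP.
    rewrite /dot (eq_bigr (fun=> 1)) => [|k _]; last by rewrite !mxE mulr1.
    by rewrite sumr_const card_ord => /eqP; rewrite pnatr_eq0 gtn_eqF.
  rewrite negb_forall => /existsP[i Pi0]; exists i.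
  have : (P *m map_mx (real_complex R) (D *m one)) i 0 =
      (lam 0 i)%:C%C * (P *m map_mx (real_complex R) one) i 0.
    by rewrite map_mxM mulmxA dP -mulmxA mul_diag_mx !mxE.
  rewrite one_fixed => /eqP; rewrite -[X in X == _]mul1r (inj_eq (mulIf Pi0)).
  by rewrite eq_sym eq_complex => /andP[/eqP].
have Pi0 k : P i0 k = P i0 i0.
  by apply: unimodular_row_constant; rewrite lam_i0 normr1.
exists i0 => // i ni.
rewrite lt_neqAle doubly_stochastic_spectrum_le1 andbT; apply/eqP => lam1.
have Pi k : P i k = P i i by exact: unimodular_row_constant.
have := row_norm i i0; rewrite (negbTE ni).
rewrite (eq_bigr (fun=> P i i * (P i0 i0)^*)) => [|k _]; last first.
  by rewrite Pi Pi0.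
rewrite sumr_const card_ord => /eqP; rewrite mulrn_eq0 gtn_eqF //=.
rewrite mulf_eq0 conjC_eq0 => /orP[] /eqP z.
  have := row_norm i i; rewrite big1 => [/eqP|k _]; last by rewrite Pi z mul0r.
  by rewrite eqxx eq_sym oner_eq0.
have := row_norm i0 i0; rewrite big1 => [/eqP|k _]; last by rewrite Pi0 z mul0r.
by rewrite eqxx eq_sym oner_eq0.
Qed.
End UnitaryDiagonalization.

(** The constant direction carries the top singular value, and by simplicity of
    the eigenvalue 1 every other eigenvalue is bounded by [sigma2 D]. Hence
    [D] contracts zero-sum vectors by the factor [sigma2 D]. *)
Lemma sigma2_gap : [/\ 0 <= sigma2 D, sigma2 D < 1 &
  forall v, \sum_i v i 0 = 0 ->
    dot (D *m v) (D *m v) <= sigma2 D ^+ 2 * dot v v].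
Proof.
have [P [lam [uP dP]]] := symmetric_diagonalizes symD.
have unP := unitarymx_unit uP.
have [n0|n_gt0] := posnP n.
  have -> : sigma2 D = 0.
    rewrite /sigma2 (singular_values_diagonalizes symD unP dP) nth_default //.
    by rewrite size_sort size_map size_enum_ord n0.
  split=> // v _; rewrite [leLHS]big1 ?mulr_ge0 ?sqr_ge0 ?dot_ge0 //.
  by move=> i; suff: (i < 0)%N by []; rewrite -[X in (_ < X)%N]n0.
have [i0 lam_i0 lam_lt1] := simple_unit_eigenvalue uP dP n_gt0.
pose t : seq R := sort >=%R [seq `|lam 0 i| | i <- enum (predC1 i0)].
have s2E : sigma2 D = t`_0.
  rewrite /sigma2 (singular_values_split symD unP dP (i0 := i0)) // => i.
  by rewrite lam_i0 normr1 (doubly_stochastic_spectrum_le1 uP dP).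
have le_s2 (i : 'I_n) : i != i0 -> `|lam 0 i| <= sigma2 D.
  move=> ni; rewrite s2E.
  have : `|lam 0 i| \in t by rewrite mem_sort; apply: map_f; rewrite mem_enum.
  have : sorted >=%R t by apply: sort_sorted => x y; exact: le_total.
  case: (t) => //= x l.
  rewrite path_sortedE => [/andP[/allP xl _]|]; last first.
    by move=> a b c ba cb; exact: le_trans ba.
  by rewrite inE => /orP[/eqP-> //|]; exact: xl.
have t_bounds : all (fun x => 0 <= x < 1) t.
  rewrite all_sort all_map; apply/allP => i; rewrite mem_enum => ni /=.
  by rewrite normr_ge0 lam_lt1.
have /andP[s2_ge0 s2_lt1] : 0 <= sigma2 D < 1.
  rewrite s2E; case: (t) t_bounds => [_|x l /= /andP[] //].
  by rewrite lexx ltr01.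
split=> // v sum_v; rewrite dot_mulmx_sym // mulmxA.
rewrite -lecR (dot_diagonalizes _ uP (diagonalizesM dP)) rmorphM /=.
rewrite (dot_unitary _ _ uP) mulr_sumr; apply: ler_sum => i _.
rewrite [X in _ <= _ * X]mulrC -normCK.
have [->|ni] := eqVneq i i0.
  have -> : (P *m map_mx (real_complex R) v) i0 0 = 0.
    rewrite mxE (eq_bigr (fun k => P i0 i0 * (v k 0)%:C%C)) => [|k _].
      by rewrite -mulr_sumr -rmorph_sum sum_v rmorph0 mulr0.
    rewrite mxE (unimodular_row_constant dP _ k i0) //.
    by rewrite lam_i0 normr1.
  by rewrite normr0 expr0n !mulr0.
rewrite ler_wpM2r ?exprn_ge0 // lecR mxE -[lam 0 i ^+ 2]real_normK ?num_real //.
by rewrite lerXn2r ?nnegrE ?le_s2.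
Qed.
End DoublyStochastic.

(** * The descent lemma *)

Section AffineDerivative.
Variables (R : realType) (U V : normedModType R).

(** The two difference quotients are the same function of the increment. This
    serves both to restrict a function to a line and to differentiate a function
    of one block of a stacked vector. *)
Lemma derive_affine (f : V -> R) (g : U -> V) (a v : U) (w : V) :
  (forall t : R, g (t *: v + a) = t *: w + g a) ->
  ('D_v (f \o g) a = 'D_w f (g a)) *
  (derivable f (g a) w -> derivable (f \o g) a v).
Proof.
move=> gE.
have E : (fun t : R => t^-1 *: ((f \o g \o shift a) (t *: v) - (f \o g) a)) =
         (fun t : R => t^-1 *: ((f \o shift (g a)) (t *: w) - f (g a))).
  by apply/funext => t /=; rewrite gE.
by split; rewrite /derive /derivable E.
Qed.
End AffineDerivative.

Section Descent.
Variables (R : realType) (d : nat) (f : 'cV[R]_d -> R) (L : R).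
Hypothesis diff_f : forall x, differentiable f x.

Lemma derive_grad x h : 'D_h f x = dot (grad f x) h.
Proof.
rewrite deriveE // [X in 'd f x X](matrix_sum_delta h) linear_sum.
apply: eq_bigr => k _; rewrite big_ord1 linearZ mxE mulrC.
by rewrite /partial deriveE.
Qed.

Hypothesis lip_f : grad_lipschitz f L.

(** Along the segment from [x] to [x + h], the function minus its quadratic
    upper model has derivative
    [dot (grad f (x + t h) - grad f x) h - t * L * dot h h], which is
    nonpositive by Cauchy-Schwarz and the Lipschitz bound. *)
Lemma descent_lemma (x h : 'cV[R]_d) :
  f (x + h) <= f x + dot (grad f x) h + L / 2 * dot h h.
Proof.
pose g (t : R) := t *: h + x.
have gE (t s : R) : g (t *: (1 : R) + s) = t *: h + g s.
  by rewrite /g [t *: 1]mulr1 scalerDl addrA.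
pose q := L * dot h h.
pose c := dot (grad f x) h.
pose phi (t : R) := f (g t) - t * c - q / 2 * t ^+ 2.
have dphi (t : R) : is_derive t 1 phi (dot (grad f (g t)) h - c - q * t).
  have ? : is_derive t 1 (f \o g) (dot (grad f (g t)) h).
    have [e dd] := derive_affine f (gE^~ t).
    by split; [exact/dd/diff_derivable | rewrite e derive_grad].
  have d1 : is_derive t 1 (fun t : R => t * c) c.
    by apply: is_derive_eq; rewrite /GRing.scale /=; ring.
  have d2 : is_derive t 1 (fun t : R => q / 2 * t ^+ 2) (q * t).
    by apply: is_derive_eq; rewrite /GRing.scale /=; field.
  exact: is_deriveB.
have dphi_le0 (t : R) : 0 <= t -> dot (grad f (g t)) h - c - q * t <= 0.
  move=> t0; rewrite -dotNl -dotDl subr_le0.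
  apply: (le_trans (dot_le_enorm _ _)).
  apply: (le_trans (ler_wpM2r (enorm_ge0 h) (lip_f (g t) x))).
  rewrite /g addrK enormZ ger0_norm // /q -sqr_enorm.
  by rewrite le_eqVlt; apply/orP; left; apply/eqP; ring.
have : phi 1 <= phi 0.
  apply: (@ler0_derive1_le_cc R phi 0 1); rewrite ?in_itv /= ?lexx ?ler01 //.
  - move=> t; rewrite in_itv /= => /andP[/ltW t0 _].
    by rewrite derive1E; have [_ ->] := dphi t; exact: dphi_le0.
  by apply: derivable_within_continuous => t _; have [] := dphi t.
rewrite /phi /g scale1r scale0r add0r expr1n expr0n /= mulr0 mul0r mulr1 mul1r.
by rewrite /q /c (addrC h x); lra.
Qed.
End Descent.

(** Outside a ball coercivity gives [0 <= f x]. On the ball, the descent lemma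
    from [x] to 0 bounds [f 0] by [f x] plus terms that the Lipschitz bound on
    the gradient controls by the radius. *)
Lemma coercive_bounded_below (R : realType) (d : nat) (f : 'cV[R]_d -> R)
    (L : R) : 0 <= L -> (forall x, differentiable f x) ->
  grad_lipschitz f L -> coercive f -> exists c, forall x, c <= f x.
Proof.
move=> L0 df lf /(_ 0)[B fB].
pose b := `|B|; pose G := enorm (grad f 0).
have b0 : 0 <= b by exact: normr_ge0.
have G0 : 0 <= G by exact: enorm_ge0.
exists (Num.min 0 (f 0 - (G + L * b) * b - L / 2 * b ^+ 2)) => x.
rewrite ge_min; have [/fB -> //|xB] := leP B (enorm x).
apply/orP; right.
have xb : enorm x <= b by rewrite ltW // (lt_le_trans xB) // ler_norm.
have x0 := enorm_ge0 x.
have := descent_lemma df lf x (- x).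
rewrite subrr dotNr dotNl dotNr opprK -sqr_enorm => le0.
have gx : enorm (grad f x) <= G + L * enorm x.
  have := enormD (grad f x - grad f 0) (grad f 0); rewrite subrK.
  by have := lf x 0; rewrite subr0 /G; lra.
have dx : - dot (grad f x) x <= (G + L * b) * b.
  rewrite -dotNr (le_trans (dot_le_enorm _ _)) // enormN.
  rewrite ler_pM ?enorm_ge0 // (le_trans gx) // lerD2l.
  exact: ler_wpM2l.
have sx : L / 2 * enorm x ^+ 2 <= L / 2 * b ^+ 2.
  by rewrite ler_wpM2l ?divr_ge0 // lerXn2r ?nnegrE.
by lra.
Qed.

(** * Stacked vectors and the aggregate function *)

Section StackedVectors.
Variables (R : realType) (n m : nat).
Implicit Types (x y : 'cV[R]_(n * m)) (D : 'M[R]_n).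

(** A stacked vector is an [n] by [m] array: [block] reads its rows, on which
    the functions [f i] act, and [fiber] its columns, on which [D] acts. *)
Definition fiber x (k : 'I_m) : 'cV[R]_n :=
  \col_(i < n) x (mxtens_index (i, k)) ord0.

Lemma sum_mxtens_index (F : 'I_(n * m) -> R) :
  \sum_p F p = \sum_(i < n) \sum_(k < m) F (mxtens_index (i, k)).
Proof.
rewrite pair_bigA (reindex (@mxtens_index n m)) /=; last first.
  exists (@mxtens_unindex n m) => p _; first exact: mxtens_indexK.
  exact: mxtens_unindexK.
by apply: eq_bigr => -[].
Qed.

Lemma dot_blocks x y : dot x y = \sum_i dot (block x i) (block y i).
Proof.
rewrite /dot sum_mxtens_index; apply: eq_bigr => i _.
by apply: eq_bigr => k _; rewrite !mxE.
Qed.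

Lemma dot_fibers x y : dot x y = \sum_k dot (fiber x k) (fiber y k).
Proof.
rewrite /dot sum_mxtens_index exchange_big; apply: eq_bigr => k _.
by apply: eq_bigr => i _; rewrite !mxE.
Qed.

Lemma block_affine (a : R) x y i :
  block (a *: x + y) i = a *: block x i + block y i.
Proof. by apply/colP => k; rewrite !mxE. Qed.

Lemma blockD x y i : block (x + y) i = block x i + block y i.
Proof. by rewrite -[x]scale1r block_affine !scale1r. Qed.

Lemma blockB x y i : block (x - y) i = block x i - block y i.
Proof. by rewrite -scaleN1r addrC block_affine scaleN1r addrC. Qed.

Lemma fiber_W D x k : fiber (W m D *m x) k = D *m fiber x k.
Proof.
apply/colP => i; rewrite !mxE sum_mxtens_index; apply: eq_bigr => j _.
rewrite (bigD1 k) //= big1 => [|l lk]; rewrite tensmxE !mxE.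
  by rewrite eqxx mulr1 addr0.
by rewrite eq_sym (negbTE lk) mulr0 mul0r.
Qed.

Section Mixing.
Variable D : 'M[R]_n.
Hypotheses (dsD : doubly_stochastic D) (symD : D^T = D).

Lemma dot_W x y : dot x (W m D *m y) = dot (W m D *m x) y.
Proof.
rewrite !dot_fibers; apply: eq_bigr => k _.
by rewrite !fiber_W dot_mulmx_sym.
Qed.

Lemma dot_W_le x : dot x (W m D *m x) <= dot x x.
Proof.
rewrite !dot_fibers; apply: ler_sum => k _.
by rewrite fiber_W doubly_stochastic_dot_le.
Qed.

Lemma W_contracts x : enorm (W m D *m x) <= enorm x.
Proof.
rewrite !enormE ler_wsqrtr // !dot_fibers; apply: ler_sum => k _.
by rewrite fiber_W doubly_stochastic_contracts.
Qed.

Lemma sigma_min_W x :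
  sigma_min (1%:M + D) * dot x x <= dot x x + dot x (W m D *m x).
Proof.
rewrite !dot_fibers mulr_sumr -big_split; apply: ler_sum => k _ /=.
rewrite fiber_W -dotDr -[X in X + D *m _]mul1mx -mulmxDl.
apply: sigma_min_Rayleigh => [|v]; first by rewrite linearD /= trmx1 symD.
rewrite mulmxDl mul1mx dotDr -lerBlDl sub0r.
exact: doubly_stochastic_dot_ge.
Qed.
End Mixing.
End StackedVectors.

Section Aggregate.
Variables (R : realType) (n m : nat) (f : 'I_n -> 'cV[R]_m -> R).
Hypothesis diff_f : forall i x, differentiable (f i) x.
Implicit Types (x h : 'cV[R]_(n * m)).

Lemma block_grad_Fc x i : block (grad (Fc f) x) i = grad (f i) (block x i).
Proof.
(* [G] stacks the block gradients, so that the claim becomes an equality of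
   stacked vectors, tested against the basis vectors. *)
pose G : 'cV[R]_(n * m) := \col_p let: (i, k) := mxtens_unindex p in
  grad (f i) (block x i) k ord0.
have blockG j : block G j = grad (f j) (block x j).
  by apply/colP => k; rewrite mxE /G mxE mxtens_indexK.
rewrite -blockG; congr (block _ i); apply/colP => p; rewrite mxE /partial.
set v := delta_mx p ord0.
have dotGv : dot G v = G p 0.
  rewrite /dot (bigD1 p) //= big1 => [|q qp]; rewrite [v _ _]mxE eqxx.
    by rewrite eqxx mulr1 addr0.
  by rewrite (negbTE qp) mulr0.
have FcE : Fc f = \sum_(j < n) (f j \o (fun y => block y j)).
  by apply/funext => y; rewrite fct_sumE.
have D j := derive_affine (f j) (g := fun y => block y j)
  (fun t => block_affine t v x j).
rewrite -dotGv dot_blocks FcE derive_sum => [|j]; last first.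
  exact/(D j).2/diff_derivable.
by apply: eq_bigr => j _; rewrite (D j).1 derive_grad // blockG.
Qed.

Lemma grad_Fsum (theta : 'cV[R]_m) :
  grad (Fsum f) theta = \sum_i grad (f i) theta.
Proof.
apply/colP => k; rewrite mxE summxE /partial.
have -> : Fsum f = \sum_(j < n) f j.
  by apply/funext => y; rewrite fct_sumE.
rewrite derive_sum => [|i]; last exact/diff_derivable.
by apply: eq_bigr => j _; rewrite mxE.
Qed.

Variable L : R.
Hypothesis lip_f : forall i, grad_lipschitz (f i) L.

Lemma Fc_descent x h :
  Fc f (x + h) <= Fc f x + dot (grad (Fc f) x) h + L / 2 * dot h h.
Proof.
rewrite !dot_blocks mulr_sumr /Fc -!big_split; apply: ler_sum => i _ /=.
by rewrite blockD block_grad_Fc descent_lemma.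
Qed.

Hypothesis L_ge0 : 0 <= L.

Lemma grad_Fc_lipschitz : grad_lipschitz (Fc f) L.
Proof.
move=> x y; rewrite -(@ler_pXn2r _ 2) // ?nnegrE ?mulr_ge0 ?enorm_ge0 //.
rewrite exprMn !sqr_enorm !dot_blocks mulr_sumr; apply: ler_sum => i _.
rewrite !blockB !block_grad_Fc -!sqr_enorm -exprMn.
by rewrite lerXn2r ?nnegrE ?mulr_ge0 ?enorm_ge0 // lip_f.
Qed.
End Aggregate.

(** * Stationarity of the limit points of DGD *)

(** Once a term is within [e] of the infimum, the sequence has less than [e]
    left to lose. *)
Lemma bounded_decreasing_steps (R : realType) (u : nat -> R) (c e : R) :
  (forall k, u k.+1 <= u k) -> (forall k, c <= u k) -> 0 < e ->
  exists N, forall k, (N <= k)%N -> u k - u k.+1 < e.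
Proof.
move=> dec_u lb_u e0; pose A := range u.
have infA : has_inf A.
  by split; [exists (u 0%N), 0%N | exists c => _ [k _ <-]].
have [_ [N _ <-] uN] := inf_adherent e0 infA.
exists N => k Nk.
have le_uN : u k <= u N.
  rewrite -(subnK Nk); elim: (k - N)%N => //= j IHj.
  by rewrite addSn (le_trans (dec_u _)).
have : inf A <= u k.+1 by apply: ge_inf; [case: infA | exists k.+1].
by lra.
Qed.

Section DGD.
Variables (R : realType) (n m : nat) (f : 'I_n -> 'cV[R]_m -> R) (L : R).
Variables (D : 'M[R]_n) (alpha : R).
Hypothesis diff_f : forall i x, differentiable (f i) x.
Hypothesis lip_f : forall i, grad_lipschitz (f i) L.
Hypotheses (dsD : doubly_stochastic D) (symD : D^T = D).
Hypotheses (L_gt0 : 0 < L) (alpha_gt0 : 0 < alpha).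
Implicit Types x y p : 'cV[R]_(n * m).

Definition dgd_step x : 'cV[R]_(n * m) :=
  W m D *m x - alpha *: grad (Fc f) x - x.

(** The function of which DGD is plain gradient descent with unit step:
    [dgd_step] is the opposite of its gradient when [D] is symmetric. *)
Definition dgd_energy x : R :=
  alpha * Fc f x + (dot x x - dot x (W m D *m x)) / 2.

(** With [h] the step, the descent lemma for [Fc] and the exact expansion of the
    quadratic part change the energy by at most
    [(alpha * L * dot h h - dot h h - dot h (W h)) / 2], and
    [sigma_min (1 + D)] bounds the form of [1 + W] from below. *)
Lemma dgd_energy_descent x :
  dgd_energy (x + dgd_step x) <= dgd_energy x -
    (sigma_min (1%:M + D) - alpha * L) / 2 * dot (dgd_step x) (dgd_step x).
Proof.
set h := dgd_step x.
have gh : alpha * dot (grad (Fc f) x) h =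
    dot (W m D *m x) h - dot x h - dot h h.
  rewrite -dotZl; have -> : alpha *: grad (Fc f) x = W m D *m x - x - h.
    by rewrite /h /dgd_step; apply/colP => k; rewrite !mxE; ring.
  by move: h => h; rewrite !(dotDl, dotNl).
clearbody h; have := Fc_descent diff_f lip_f x h.
rewrite -(ler_pM2l alpha_gt0) !mulrDr gh => dF.
have := sigma_min_W dsD symD h.
rewrite /dgd_energy mulmxDr !(dotDl, dotDr) (dotC h x) (dot_W symD x h).
rewrite (dotC h (W m D *m x)); move: dF; rewrite mulrA.
by lra.
Qed.

Lemma dgd_step_lipschitz x y :
  enorm (dgd_step x - dgd_step y) <= (2 + alpha * L) * enorm (x - y).
Proof.
have -> : dgd_step x - dgd_step y = W m D *m (x - y) +
    (- (alpha *: (grad (Fc f) x - grad (Fc f) y)) - (x - y)).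
  rewrite /dgd_step mulmxBr; apply/colP => k; rewrite !mxE; ring.
apply: (le_trans (enormD _ _)).
have := enormD (- (alpha *: (grad (Fc f) x - grad (Fc f) y))) (- (x - y)).
rewrite !enormN enormZ gtr0_norm //.
have := grad_Fc_lipschitz diff_f lip_f (ltW L_gt0) x y.
rewrite -(ler_pM2l alpha_gt0) mulrA.
by have := W_contracts dsD symD (x - y); lra.
Qed.

Hypothesis alpha_lt : alpha * L < sigma_min (1%:M + D).
Hypothesis coercive_f : forall i, coercive (f i).
Variables (x0 : 'cV[R]_(n * m)) (H : R).
Local Notation u := (dgd D f alpha x0).

Lemma dgdS k : u k.+1 = u k + dgd_step (u k).
Proof. by rewrite /dgd_step [RHS]addrC subrK. Qed.

Lemma dgd_energy_bounded : exists c, forall x, c <= dgd_energy x.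
Proof.
have /fin_all_exists[c cP] i :=
  coercive_bounded_below (ltW L_gt0) (diff_f i) (lip_f i) (coercive_f i).
exists (alpha * \sum_i c i) => x; rewrite /dgd_energy -[leLHS]addr0 lerD //.
  by rewrite ler_pM2l // ler_sum.
by rewrite divr_ge0 // subr_ge0 dot_W_le.
Qed.

Lemma dgd_step_vanishes e : 0 < e ->
  exists N, forall k, (N <= k)%N -> enorm (dgd_step (u k)) < e.
Proof.
move=> e0; pose s := (sigma_min (1%:M + D) - alpha * L) / 2.
have s0 : 0 < s by rewrite divr_gt0 // subr_gt0.
have [c cP] := dgd_energy_bounded.
have dec k : dgd_energy (u k.+1) <=
    dgd_energy (u k) - s * enorm (dgd_step (u k)) ^+ 2.
  by rewrite dgdS sqr_enorm dgd_energy_descent.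
have [k|k||N NP] :=
  @bounded_decreasing_steps R (fun k => dgd_energy (u k)) c (s * e ^+ 2).
- by rewrite (le_trans (dec k)) // gerBl mulr_ge0 ?sqr_ge0 ?ltW.
- exact: cP.
- by rewrite mulr_gt0 ?exprn_gt0.
exists N => k /NP lt_k.
rewrite -(@ltr_pXn2r _ 2) // ?nnegrE ?enorm_ge0 ?ltW // -(ltr_pM2l s0).
by have := dec k; lra.
Qed.

Section LimitPoint.
Variable p : 'cV[R]_(n * m).
Hypothesis limit_p : seq_limit_point u p.

Lemma dgd_near_limit e : 0 < e ->
  exists k, enorm (u k - p) < e /\ enorm (dgd_step (u k)) < e.
Proof.
move=> e0; have [N NP] := dgd_step_vanishes e0.
have nbhsN : (u @ \oo)%classic (u @` [set k | (N <= k)%N])%classic.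
  by exists N => // k /= Nk; exists k.
have [_ [[k Nk <-] kp]] := limit_p nbhsN (nbhs_enorm p e0).
by exists k; split=> //; exact: NP.
Qed.

(** [dgd_step] is Lipschitz and takes arbitrarily small values at iterates
    arbitrarily close to [p]. *)
Lemma limit_point_stationary : dgd_step p = 0.
Proof.
apply/eqP; rewrite -enorm_eq0 eq_le enorm_ge0 andbT.
apply/ler_addgt0Pr => e e0; rewrite add0r.
have c0 : 0 < 3 + alpha * L by rewrite addr_gt0 // mulr_gt0.
pose z := e / (3 + alpha * L).
have -> : e = z + (2 + alpha * L) * z.
  by rewrite /z; field; rewrite gt_eqF.
have [k [kp sk]] := dgd_near_limit (divr_gt0 e0 c0).
have := enormD (dgd_step (u k)) (dgd_step p - dgd_step (u k)).
rewrite addrC subrK enormB => /le_trans; apply.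
rewrite lerD ?(ltW sk) // (le_trans (dgd_step_lipschitz _ _)) //.
by rewrite ler_wpM2l ?(ltW kp) // addr_ge0 // mulr_ge0 // ltW.
Qed.

Lemma limit_point_grad_bound :
  (forall k, enorm (grad (Fc f) (u k)) <= H) -> enorm (grad (Fc f) p) <= H.
Proof.
move=> boundH; apply/ler_addgt0Pr => e e0.
have [k [kp _]] := dgd_near_limit (divr_gt0 e0 L_gt0).
have := enormD (grad (Fc f) (u k)) (grad (Fc f) p - grad (Fc f) (u k)).
rewrite addrC subrK enormB.
have := grad_Fc_lipschitz diff_f lip_f (ltW L_gt0) (u k) p.
move: kp; rewrite ltr_pdivlMr // mulrC => kp.
by have := boundH k; lra.
Qed.
End LimitPoint.

(** * Consensus error and criticality of the mean *)

Section StationaryPoint.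
Variables (E : rel 'I_n) (p : 'cV[R]_(n * m)).
Hypotheses (n_gt0 : (0 < n)%N) (cD : compliant E D) (cE : connected_graph E).
Hypothesis stat_p : dgd_step p = 0.
Hypothesis boundH : enorm (grad (Fc f) p) <= H.

Lemma stationary_fiber k :
  D *m fiber p k - fiber p k = alpha *: fiber (grad (Fc f) p) k.
Proof.
rewrite -fiber_W; apply/colP => i.
have /colP/(_ (mxtens_index (i, k))) := stat_p.
by rewrite /dgd_step !mxE; lra.
Qed.

(** Summing the stationarity equations over the agents kills the mixing term,
    as the columns of [D] sum to 1. *)
Lemma stationary_grad_sum : \sum_i grad (f i) (block p i) = 0.
Proof.
have [_ _ col1] := dsD.
apply/colP => k; rewrite summxE mxE.
have -> : \sum_i grad (f i) (block p i) k 0 =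
    \sum_i fiber (grad (Fc f) p) k i 0.
  by apply: eq_bigr => i _; rewrite -block_grad_Fc // !mxE.
apply: (mulfI (lt0r_neq0 alpha_gt0)); rewrite mulr0 mulr_sumr.
transitivity (\sum_i (D *m fiber p k - fiber p k) i 0).
  by apply: eq_bigr => i _; rewrite stationary_fiber [RHS]mxE.
under eq_bigr do rewrite 2!mxE [X in _ + X]mxE.
rewrite sumrB exchange_big; apply/eqP; rewrite subr_eq0; apply/eqP.
by apply: eq_bigr => j _; rewrite -mulr_suml col1 mul1r.
Qed.

Definition deviation : 'cV[R]_(n * m) :=
  \col_q (p q 0 - block_mean p (mxtens_unindex q).2 0).

Lemma block_deviation i : block deviation i = block p i - block_mean p.
Proof. by apply/colP => k; rewrite !mxE mxtens_indexK. Qed.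

(** On each fiber the deviation [y] from the mean sums to zero, hence
    [enorm y <= enorm (D y) + enorm (D y - y)] with
    [enorm (D y) <= sigma2 D * enorm y],
    while stationarity identifies [D y - y] with [alpha] times the fiber of the
    gradient. Squaring and summing over fibers gives the bound. *)
Lemma consensus_error :
  (1 - sigma2 D) * enorm deviation <= alpha * H.
Proof.
have [s2_ge0 s2_lt1 gap] := sigma2_gap dsD symD cD cE.
have H0 : 0 <= H by rewrite (le_trans _ boundH) ?enorm_ge0.
have s1 : 0 <= 1 - sigma2 D by rewrite subr_ge0 ltW.
have fib k : (1 - sigma2 D) * enorm (fiber deviation k) <=
    alpha * enorm (fiber (grad (Fc f) p) k).
  set y := fiber deviation k.
  have yE : y = fiber p k - const_mx (block_mean p k 0).
    by apply/colP => i; rewrite !mxE mxtens_indexK.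
  have Dconst c : D *m const_mx c = const_mx c :> 'cV[R]_n.
    have [_ row1 _] := dsD; apply/colP => i; rewrite !mxE.
    by under eq_bigr do rewrite mxE; rewrite -mulr_suml row1 mul1r.
  have sum_y : \sum_i y i 0 = 0.
    rewrite yE; under eq_bigr do rewrite !mxE.
    rewrite sumrB sumr_const card_ord -[X in _ - X]mulr_natl summxE.
    rewrite mulVKf ?pnatr_eq0 -?lt0n //; apply/eqP; rewrite subr_eq0; apply/eqP.
    by apply: eq_bigr => i _; rewrite mxE.
  have Dy : D *m y - y = alpha *: fiber (grad (Fc f) p) k.
    rewrite -stationary_fiber yE mulmxBr Dconst.
    by apply/colP => i; rewrite !mxE; ring.
  have Dy_le : enorm (D *m y) <= sigma2 D * enorm y.
    rewrite -(@ler_pXn2r _ 2) // ?nnegrE ?mulr_ge0 ?enorm_ge0 //.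
    by rewrite exprMn !sqr_enorm gap.
  have := enormD (D *m y) (- (D *m y - y)).
  rewrite opprB addrC subrK enormB Dy enormZ gtr0_norm //.
  by lra.
rewrite -(@ler_pXn2r _ 2) // ?nnegrE ?mulr_ge0 ?enorm_ge0 ?(ltW alpha_gt0) //.
have : (alpha * enorm (grad (Fc f) p)) ^+ 2 <= (alpha * H) ^+ 2.
  rewrite lerXn2r ?nnegrE ?mulr_ge0 ?enorm_ge0 ?(ltW alpha_gt0) //.
  by rewrite ler_pM2l.
apply: le_trans; rewrite !exprMn !sqr_enorm !dot_fibers !mulr_sumr.
apply: ler_sum => k _; rewrite -!sqr_enorm -!exprMn.
by rewrite lerXn2r ?nnegrE ?mulr_ge0 ?enorm_ge0 ?(ltW alpha_gt0).
Qed.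

Lemma sum_deviation_le :
  \sum_i enorm (block deviation i) <= Num.sqrt n%:R * enorm deviation.
Proof.
(* Cauchy-Schwarz against the all-ones vector. *)
pose a : 'cV[R]_n := \col_i enorm (block deviation i).
have -> : \sum_i enorm (block deviation i) = dot (const_mx 1) a.
  by apply: eq_bigr => i _; rewrite !mxE mul1r.
rewrite (le_trans (dot_le_enorm _ _)) // !enormE.
have -> : dot (const_mx 1 : 'cV[R]_n) (const_mx 1) = n%:R.
  rewrite /dot (eq_bigr (fun=> 1)) => [|i _]; last by rewrite !mxE mulr1.
  by rewrite sumr_const card_ord.
have -> // : dot a a = dot deviation deviation.
rewrite dot_blocks; apply: eq_bigr => i _.
by rewrite mxE -expr2 sqr_enorm.
Qed.

(** As the gradients at the blocks sum to zero, the gradient of the sum at the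
    mean is a sum of increments of gradients, each at most [L] times a
    deviation. *)
Lemma stationary_mean_critical :
  enorm (grad (Fsum f) (block_mean p)) <=
    n%:R * Num.sqrt n%:R * L * H / (1 - sigma2 D) * alpha.
Proof.
have [s2_ge0 s2_lt1 _] := sigma2_gap dsD symD cD cE.
have s1 : 0 < 1 - sigma2 D by rewrite subr_gt0.
have H0 : 0 <= H by rewrite (le_trans _ boundH) ?enorm_ge0.
have dev : enorm deviation <= alpha * H / (1 - sigma2 D).
  by rewrite ler_pdivlMr // mulrC consensus_error.
have n1 : (1 : R) <= n%:R by rewrite ler1n.
have -> : grad (Fsum f) (block_mean p) =
    \sum_i (grad (f i) (block_mean p) - grad (f i) (block p i)).
  by rewrite grad_Fsum // sumrB stationary_grad_sum subr0.
rewrite (le_trans (enorm_sum _ _)) //.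
apply: (@le_trans _ _ (L * \sum_i enorm (block deviation i))).
  rewrite mulr_sumr ler_sum // => i _.
  by rewrite block_deviation enormB lip_f.
apply: (@le_trans _ _ (L * (Num.sqrt n%:R * (alpha * H / (1 - sigma2 D))))).
  rewrite ler_pM2l // (le_trans sum_deviation_le) //.
  by rewrite ler_wpM2l ?sqrtr_ge0.
set q := Num.sqrt _.
have -> : n%:R * q * L * H / (1 - sigma2 D) * alpha =
    n%:R * (L * (q * (alpha * H / (1 - sigma2 D)))).
  by field; rewrite gt_eqF.
(* The deviations only cost a factor [sqrt n], and [n >= 1]. *)
by rewrite ler_peMl // !mulr_ge0 ?invr_ge0 ?sqrtr_ge0 // ltW.
Qed.
End StationaryPoint.
End DGD.

Unset Implicit Arguments.

Theorem lemma3p6 (R : realType) (n m r : nat)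
    (f : 'I_n -> 'cV[R]_m -> R) (L : 'I_n -> R)
    (E : rel 'I_n) (D : 'M[R]_n)
    (x0 : 'cV[R]_(n * m)) (alpha H : R) :
  (0 < n)%N -> (1 <= r)%N ->
  (forall i, coercive (f i)) ->
  (forall i, Ck r.+1 (f i)) ->
  (forall i, grad_lipschitz (f i) (L i)) ->
  symmetric E -> connected_graph E ->
  doubly_stochastic D -> D^T = D -> compliant E D ->
  0 < alpha -> alpha < sigma_min (1%:M + D) / Lmax L ->
  (forall nu : nat, enorm (grad (Fc f) (dgd D f alpha x0 nu)) <= H) ->
  forall xinf : 'cV[R]_(n * m),
    seq_limit_point (dgd D f alpha x0) xinf ->
    let K' := n%:R * Num.sqrt n%:R * Lmax L * H / (1 - sigma2 D) in
    eps_critical (Fsum f) (K' * alpha) (block_mean xinf).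
Proof.
move=> n_gt0 _ coercive_f Ck_f lip_f _ cE dsD symD cD alpha_gt0 alpha_lt boundH.
move=> p limit_p /=; rewrite /eps_critical.
have diff_f i x : differentiable (f i) x by have [] := Ck_f i.
have lip_max i : grad_lipschitz (f i) (Lmax L).
  move=> x y; rewrite (le_trans (lip_f i x y)) // ler_wpM2r ?enorm_ge0 //.
  exact: (le_bigmax _ L i).
(* If [Lmax L] were 0, so would be the quotient bounding [alpha]. *)
have L_gt0 : 0 < Lmax L.
  rewrite lt_neqAle bigmax_ge_id andbT.
  apply: contraTneq alpha_lt => <-.
  by rewrite invr0 mulr0 -leNgt ltW.
have alpha_L : alpha * Lmax L < sigma_min (1%:M + D) by rewrite -ltr_pdivlMr.
apply: (stationary_mean_critical diff_f lip_max dsD symD L_gt0 alpha_gt0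
  n_gt0 cD cE).
  exact: (limit_point_stationary diff_f lip_max dsD symD L_gt0 alpha_gt0
    alpha_L coercive_f limit_p).
exact: (limit_point_grad_bound diff_f lip_max dsD symD L_gt0 alpha_gt0
    alpha_L coercive_f limit_p boundH).
Qed.
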